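(* For every real number $x$ with $0 < x < \pi/2$, $$2 - \frac{x^2}{2} < \frac{x}{\sin x} + \left(\frac{\tanh x}{x}\right)^2 < 2 < 2 + \frac{x^4}{180} < \left(\frac{\sin x}{x}\right)^2 + \frac{x}{\tanh x}.$$ *)

(* Defs.v *)
From Stdlib Require Export Reals.

(* Main.v *)
Require Import Defs.
From Stdlib Require Import Reals.
From Stdlib Require Import Arith Lra Psatz.
Open Scope R_scope.

(** With [t = x ^ 2], everything reduces to polynomial inequalities in [t]:
    [sin x] is squeezed between consecutive Taylor polynomials, [tanh x]
    between the consecutive continued-fraction convergents [3 x / (3 + t)] and
    [x (15 + t) / (15 + 6 t)], and the crude bound [PI ^ 2 < 10] gives
    [t < 5 / 2], which is enough for each of them. *)

(** * Hyperbolic inequalities behind the convergents of [tanh] *)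

Lemma pos_of_derive_pos (f f' : R -> R) :
  f 0 = 0 ->
  (forall x, derivable_pt_lim f x (f' x)) ->
  (forall x, 0 < x -> 0 < f' x) ->
  forall x, 0 < x -> 0 < f x.
Proof.
intros f0 df f'pos x x_gt0.
destruct (MVT_cor2 f f' 0 x x_gt0 (fun c _ => df c)) as [c [eqf c_in]].
assert (0 < f' c * (x - 0)) by (apply Rmult_lt_0_compat; [apply f'pos|]; lra).
lra.
Qed.

Lemma sinh_pos (x : R) : 0 < x -> 0 < sinh x.
Proof.
intros x_gt0; rewrite <- sinh_0; now apply sinh_lt.
Qed.

Lemma cosh_pos (x : R) : 0 < cosh x.
Proof.
unfold cosh; pose proof (exp_pos x); pose proof (exp_pos (- x)); lra.
Qed.

Lemma derivable_pt_lim_ext_value (f : R -> R) (x l l' : R) :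
  derivable_pt_lim f x l -> l = l' -> derivable_pt_lim f x l'.
Proof. now intros df <-. Qed.

Lemma derivable_pt_lim_cosh_sinh_comb (p q p' q' : R -> R) (x : R) :
  derivable_pt_lim p x (p' x) -> derivable_pt_lim q x (q' x) ->
  derivable_pt_lim (fun y => p y * cosh y + q y * sinh y) x
    ((p' x + q x) * cosh x + (p x + q' x) * sinh x).
Proof.
intros dp dq.
eapply derivable_pt_lim_ext_value.
- apply (derivable_pt_lim_plus (mult_fct p cosh) (mult_fct q sinh));
    apply derivable_pt_lim_mult; eauto using derivable_pt_lim_cosh,
      derivable_pt_lim_sinh.
- ring.
Qed.

Lemma derivable_pt_lim_cubic (a b c d x : R) :
  derivable_pt_lim (fun y => a + b * y + c * y ^ 2 + d * y ^ 3) x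
    (b + 2 * c * x + 3 * d * x ^ 2).
Proof.
eapply derivable_pt_lim_ext_value.
- apply (derivable_pt_lim_plus
    (plus_fct (plus_fct (fct_cte a) (mult_real_fct b id))
      (mult_real_fct c (fun y => y ^ 2))) (mult_real_fct d (fun y => y ^ 3))).
  + repeat apply derivable_pt_lim_plus; [apply derivable_pt_lim_const| |];
      apply derivable_pt_lim_scal;
      [apply derivable_pt_lim_id|apply derivable_pt_lim_pow].
  + apply derivable_pt_lim_scal, derivable_pt_lim_pow.
- simpl; ring.
Qed.

(** The hypothesis is positivity of the derivative; the missing constant term in the [cosh] factor
    makes the function vanish at 0. Explicit coefficients let unification supply the derivative,
    which is why later goals are padded with zero terms. *)
Lemma cubic_cosh_sinh_pos (a1 a2 a3 b0 b1 b2 b3 : R) :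
  (forall x, 0 < x ->
     0 < (a1 + 2 * a2 * x + 3 * a3 * x ^ 2
            + (b0 + b1 * x + b2 * x ^ 2 + b3 * x ^ 3)) * cosh x
         + (0 + a1 * x + a2 * x ^ 2 + a3 * x ^ 3
            + (b1 + 2 * b2 * x + 3 * b3 * x ^ 2)) * sinh x) ->
  forall x, 0 < x ->
    0 < (0 + a1 * x + a2 * x ^ 2 + a3 * x ^ 3) * cosh x
        + (b0 + b1 * x + b2 * x ^ 2 + b3 * x ^ 3) * sinh x.
Proof.
intros H; apply (pos_of_derive_pos _ _) with (3 := H).
- rewrite sinh_0; ring.
- intros x.
  apply (derivable_pt_lim_cosh_sinh_comb
    (fun y => 0 + a1 * y + a2 * y ^ 2 + a3 * y ^ 3)
    (fun y => b0 + b1 * y + b2 * y ^ 2 + b3 * y ^ 3)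
    (fun y => a1 + 2 * a2 * y + 3 * a3 * y ^ 2)
    (fun y => b1 + 2 * b2 * y + 3 * b3 * y ^ 2));
    apply derivable_pt_lim_cubic.
Qed.

(** The difference of the two sides has derivative [x * sinh x]. This starts a chain: in each of the
    next two lemmas the difference has as derivative [x] times the difference of the preceding
    lemma. *)
Lemma sinh_lt_x_cosh (x : R) : 0 < x -> sinh x < x * cosh x.
Proof.
intros x_gt0.
enough (0 < (0 + 1 * x + 0 * x ^ 2 + 0 * x ^ 3) * cosh x
            + (-1 + 0 * x + 0 * x ^ 2 + 0 * x ^ 3) * sinh x) by lra.
revert x x_gt0; apply cubic_cosh_sinh_pos; intros x x_gt0.
pose proof (Rmult_lt_0_compat _ _ x_gt0 (sinh_pos x x_gt0)); lra.
Qed.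

Lemma cosh_lt_sinh_convergent (x : R) :
  0 < x -> 3 * x * cosh x < (3 + x ^ 2) * sinh x.
Proof.
intros x_gt0.
enough (0 < (0 + -3 * x + 0 * x ^ 2 + 0 * x ^ 3) * cosh x
            + (3 + 0 * x + 1 * x ^ 2 + 0 * x ^ 3) * sinh x) by lra.
revert x x_gt0; apply cubic_cosh_sinh_pos; intros x x_gt0.
assert (0 < x * (x * cosh x - sinh x)).
{ apply Rmult_lt_0_compat; [|pose proof (sinh_lt_x_cosh x x_gt0)]; lra. }
lra.
Qed.

Lemma sinh_lt_cosh_convergent (x : R) :
  0 < x -> (15 + 6 * x ^ 2) * sinh x < x * (15 + x ^ 2) * cosh x.
Proof.
intros x_gt0.
enough (0 < (0 + 15 * x + 0 * x ^ 2 + 1 * x ^ 3) * cosh x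
            + (-15 + 0 * x + -6 * x ^ 2 + 0 * x ^ 3) * sinh x) by lra.
revert x x_gt0; apply cubic_cosh_sinh_pos; intros x x_gt0.
assert (0 < x * ((3 + x ^ 2) * sinh x - 3 * x * cosh x)).
{ apply Rmult_lt_0_compat;
    [|pose proof (cosh_lt_sinh_convergent x x_gt0)]; lra. }
lra.
Qed.

Lemma tanh_div_bounds (x : R) : 0 < x ->
  3 / (3 + x ^ 2) < tanh x / x < (15 + x ^ 2) / (15 + 6 * x ^ 2).
Proof.
intros x_gt0.
pose proof (cosh_pos x) as c_gt0.
pose proof (cosh_lt_sinh_convergent x x_gt0) as lo.
pose proof (sinh_lt_cosh_convergent x x_gt0) as hi.
pose proof (pow2_ge_0 x) as t_ge0.
assert (0 < cosh x * x) by now apply Rmult_lt_0_compat.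
replace (tanh x / x) with (sinh x / (cosh x * x)) by (unfold tanh; field; lra).
split.
- apply Rmult_lt_reg_r with ((3 + x ^ 2) * (cosh x * x)); [nra|].
  replace (3 / (3 + x ^ 2) * ((3 + x ^ 2) * (cosh x * x)))
    with (3 * x * cosh x) by (field; lra).
  replace (sinh x / (cosh x * x) * ((3 + x ^ 2) * (cosh x * x)))
    with ((3 + x ^ 2) * sinh x) by (field; lra).
  exact lo.
- apply Rmult_lt_reg_r with ((15 + 6 * x ^ 2) * (cosh x * x)); [nra|].
  replace (sinh x / (cosh x * x) * ((15 + 6 * x ^ 2) * (cosh x * x)))
    with ((15 + 6 * x ^ 2) * sinh x) by (field; lra).
  replace ((15 + x ^ 2) / (15 + 6 * x ^ 2)
             * ((15 + 6 * x ^ 2) * (cosh x * x)))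
    with (x * (15 + x ^ 2) * cosh x) by (field; lra).
  exact hi.
Qed.

(** * Taylor bounds for the sine, and a bound on [PI] *)

Lemma INR_fact_S (n : nat) : INR (fact (S n)) = INR (S n) * INR (fact n).
Proof. now rewrite fact_simpl, mult_INR. Qed.

Lemma sin_approx_2 (x : R) : sin_approx x 2 = x - x ^ 3 / 6 + x ^ 5 / 120.
Proof.
unfold sin_approx, sin_term; cbn [sum_f_R0 Nat.mul Nat.add].
rewrite !INR_fact_S; simpl; field.
Qed.

Lemma sin_approx_3 (x : R) :
  sin_approx x 3 = x - x ^ 3 / 6 + x ^ 5 / 120 - x ^ 7 / 5040.
Proof.
unfold sin_approx, sin_term; cbn [sum_f_R0 Nat.mul Nat.add].
rewrite !INR_fact_S; simpl; field.
Qed.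

Lemma cos_approx_4 (x : R) :
  cos_approx x 4 = 1 - x ^ 2 / 2 + x ^ 4 / 24 - x ^ 6 / 720 + x ^ 8 / 40320.
Proof.
unfold cos_approx, cos_term; cbn [sum_f_R0 Nat.mul Nat.add].
rewrite !INR_fact_S; simpl; field.
Qed.

Lemma sin_div_bounds (x : R) : 0 < x <= PI ->
  1 - x ^ 2 / 6 + (x ^ 2) ^ 2 / 120 - (x ^ 2) ^ 3 / 5040 <= sin x / x
    <= 1 - x ^ 2 / 6 + (x ^ 2) ^ 2 / 120.
Proof.
intros [x_gt0 x_le].
(* At index [n], [sin_bound] has degree [4 n + 3] below and [4 n + 5] above, so the consecutive
   degrees 7 and 5 come from different indices. *)
destruct (sin_bound x 1) as [lo _]; [lra..|].
destruct (sin_bound x 0) as [_ hi]; [lra..|].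
change (2 * 1 + 1)%nat with 3%nat in lo; rewrite sin_approx_3 in lo.
change (2 * (0 + 1))%nat with 2%nat in hi; rewrite sin_approx_2 in hi.
split; apply Rmult_le_reg_r with x; trivial;
  replace (sin x / x * x) with (sin x) by (field; lra); lra.
Qed.

(** Otherwise [cos] would be nonnegative at 1.58, where its Taylor upper bound of degree 8 is
    already negative. The value 1.58 serves because its square 2.4964 is below 5/2. *)
Lemma PI2_lt_158_100 : PI / 2 < 158 / 100.
Proof.
destruct (Rlt_le_dec (PI / 2) (158 / 100)) as [|le]; trivial.
destruct (cos_bound (158 / 100) 1) as [_ hi]; [lra..|].
assert (0 <= cos (158 / 100)) by (apply cos_ge_0; lra).
change (2 * (1 + 1))%nat with 4%nat in hi; rewrite cos_approx_4 in hi; lra.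
Qed.

(** * Polynomial and rational inequalities for [t] below 5/2 *)

Lemma inv_sin_taylor_bound (t : R) : 0 < t < 5 / 2 ->
  1 < (1 + t / 6 + 3 * t ^ 2 / 100)
      * (1 - t / 6 + t ^ 2 / 120 - t ^ 3 / 5040).
Proof.
(* The series of [x / sin x] begins [1 + t / 6 + 7 * t ^ 2 / 360]; enlarging 7/360 to 3/100 absorbs
   the higher terms. The next lemma uses the opposite correction, so that the two bounds add up to
   2. *)
intros t_in.
enough (0 < t ^ 2 * (19 / 1800 - 2 / 525 * t
  + t ^ 2 * (41 / 189000 - t / 168000))) by lra.
apply Rmult_lt_0_compat; [nra|].
assert (0 <= t ^ 2 * (41 / 189000 - t / 168000 - 1 / 5000))
  by (apply Rmult_le_pos; nra).
nra.
Qed.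

Lemma tanh_convergent_sq_bound (t : R) : 0 < t < 5 / 2 ->
  ((15 + t) / (15 + 6 * t)) ^ 2 < 1 - t / 6 - 3 * t ^ 2 / 100.
Proof.
intros t_in.
apply Rmult_lt_reg_r with ((15 + 6 * t) ^ 2); [nra|].
replace (((15 + t) / (15 + 6 * t)) ^ 2 * (15 + 6 * t) ^ 2)
  with ((15 + t) ^ 2) by (field; lra).
enough (0 < t * (112.5 - 1.75 * t - 11.4 * t ^ 2 - 1.08 * t ^ 3)) by lra.
apply Rmult_lt_0_compat; [lra|].
(* The bracket decreases in [t], and it is still positive when the powers of [t] take their values
   at 5/2. *)
assert (t ^ 2 < 6.25) by nra.
assert (t ^ 3 < 15.625) by nra.
lra.
Qed.

(** The left side is the Taylor polynomial of [(sin x / x) ^ 2], so the difference begins at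
    [t ^ 4], with a positive coefficient. *)
Lemma sin_taylor_sq_bound (t : R) : 0 < t < 5 / 2 ->
  1 - t / 3 + 2 * t ^ 2 / 45 - t ^ 3 / 315
    <= (1 - t / 6 + t ^ 2 / 120 - t ^ 3 / 5040) ^ 2.
Proof.
intros t_in.
enough (0 <= (t ^ 2) ^ 2 * (1 / 14400 + 1 / 15120 - t / 302400
  + t ^ 2 / 25401600)) by lra.
apply Rmult_le_pos; nra.
Qed.

(** The quotient expands as [1 + t / 3 - t ^ 2 / 45 + ...]: the linear terms cancel and [t ^ 2 / 45]
    remains, four times what is claimed. *)
Lemma coth_convergent_bound (t : R) : 0 < t < 5 / 2 ->
  2 + t ^ 2 / 180
    < 1 - t / 3 + 2 * t ^ 2 / 45 - t ^ 3 / 315 + (15 + 6 * t) / (15 + t).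
Proof.
intros t_in.
apply Rmult_lt_reg_r with (15 + t); [lra|].
replace ((1 - t / 3 + 2 * t ^ 2 / 45 - t ^ 3 / 315 + (15 + 6 * t) / (15 + t))
           * (15 + t))
  with ((1 - t / 3 + 2 * t ^ 2 / 45 - t ^ 3 / 315) * (15 + t) + (15 + 6 * t))
  by (field; lra).
enough (0 < t ^ 2 * (1 / 4 - 11 / 1260 * t - t ^ 2 / 315)) by lra.
apply Rmult_lt_0_compat; nra.
Qed.

Theorem theorem1 :
  forall x : R, 0 < x < PI / 2 ->
    2 - x ^ 2 / 2 < x / sin x + (tanh x / x) ^ 2 /\
    x / sin x + (tanh x / x) ^ 2 < 2 /\
    2 < 2 + x ^ 4 / 180 /\
    2 + x ^ 4 / 180 < (sin x / x) ^ 2 + x / tanh x.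
Proof.
intros x [x_gt0 x_lt].
pose proof PI2_lt_158_100 as pi_lt.
destruct (sin_div_bounds x) as [s_lo s_hi]; [lra|].
destruct (tanh_div_bounds x x_gt0) as [h_lo h_hi].
assert (s_gt0 : 0 < sin x) by (apply sin_gt_0; lra).
assert (th_gt0 : 0 < tanh x)
  by (apply Rdiv_lt_0_compat; [now apply sinh_pos|apply cosh_pos]).
replace (x / sin x) with (/ (sin x / x)) by (field; lra).
replace (x / tanh x) with (/ (tanh x / x)) by (field; lra).
replace (x ^ 4) with ((x ^ 2) ^ 2) by ring.
assert (t_in : 0 < x ^ 2 < 5 / 2) by nra.
apply (Rdiv_lt_0_compat _ x) in s_gt0, th_gt0; trivial.
revert s_lo s_hi h_lo h_hi s_gt0 th_gt0 t_in.
(* From here only the bounds on [s] and [h] in terms of [t] matter. *)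
generalize (sin x / x) as s, (tanh x / x) as h, (x ^ 2) as t.
clear x x_gt0 x_lt pi_lt; intros s h t s_lo s_hi h_lo h_hi s_gt0 h_gt0 t_in.
pose proof (inv_sin_taylor_bound t t_in) as inv_sin.
pose proof (tanh_convergent_sq_bound t t_in) as tanh_sq.
pose proof (sin_taylor_sq_bound t t_in) as sin_sq.
pose proof (coth_convergent_bound t t_in) as coth.
assert (sinV : s * / s = 1) by (field; lra).
assert (sV_gt0 := Rinv_0_lt_compat s s_gt0).
repeat split.
(* A convex function of [t] lies above its tangent at 0. Added to the bound [1 + t / 6] for [/ s],
   this tangent gives exactly [2 - t / 2]. *)
- assert (1 - 2 * t / 3 <= (3 / (3 + t)) ^ 2).
  { replace ((3 / (3 + t)) ^ 2) with
      (1 - 2 * t / 3 + t ^ 2 * (9 + 2 * t) / (3 * (3 + t) ^ 2))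
      by (field; lra).
    enough (0 <= t ^ 2 * (9 + 2 * t) / (3 * (3 + t) ^ 2)) by lra.
    apply Rlt_le, Rdiv_lt_0_compat; nra. }
  assert (1 + t / 6 < / s).
  { apply Rmult_lt_reg_l with s; trivial; rewrite sinV.
    apply Rle_lt_trans with ((1 - t / 6 + t ^ 2 / 120) * (1 + t / 6));
      [apply Rmult_le_compat_r; lra|].
    enough (0 < t ^ 2 * (7 / 360 - t / 720)) by lra.
    apply Rmult_lt_0_compat; nra. }
  assert (0 < 3 / (3 + t)) by (apply Rdiv_lt_0_compat; lra).
  assert ((3 / (3 + t)) ^ 2 < h ^ 2) by nra.
  lra.
- assert (/ s < 1 + t / 6 + 3 * t ^ 2 / 100).
  { apply Rmult_lt_reg_l with s; trivial; rewrite sinV, Rmult_comm.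
    eapply Rlt_le_trans; [exact inv_sin|apply Rmult_le_compat_l; nra]. }
  assert (h ^ 2 < ((15 + t) / (15 + 6 * t)) ^ 2) by nra.
  lra.
- nra.
- assert ((15 + 6 * t) / (15 + t) < / h).
  { replace ((15 + 6 * t) / (15 + t)) with (/ ((15 + t) / (15 + 6 * t)))
      by (field; lra).
    apply Rinv_lt_contravar; trivial; apply Rmult_lt_0_compat; lra. }
  assert (0 <= 1 - t / 6 + t ^ 2 / 120 - t ^ 3 / 5040) by nra.
  assert ((1 - t / 6 + t ^ 2 / 120 - t ^ 3 / 5040) ^ 2 <= s ^ 2)
    by (apply pow_incr; lra).
  lra.
Qed.
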